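(* Let $f(\mathbf{x})\in\mathbb{R}[x_1,\dots,x_n]$ be a determinantal polynomial of degree $d$ written in the form $$f(\mathbf{x})=\det(I+x_1D_1+x_2A_{12}+\dots+x_nA_{1n}),$$ where $D_1$ is a real diagonal $d\times d$ matrix and, for $i=2,\dots,n$, $A_{1i}=V_{1i}D_iV_{1i}^{*}$ with $D_i$ real diagonal and $V_{1i}$ unitary (orthogonal in the symmetric case). Then the non-zero eigenvalues of the coefficient matrices ($D_1$ for $i=1$, $A_{1i}$ for $i=2,\dots,n$) are the negative reciprocals of the roots of the univariate polynomials $f_{x_i}=f(0,\dots,0,x_i,0,\dots,0)$, for all $i=1,\dots,n$.
   Context: Determinantal means that $f(\mathbf{x})=\det(I+x_1A_1+\dots+x_nA_n)$ with $A_i$ symmetric or Hermitian matrices; only representations of size $d=\deg f$ are considered. After a unitary (orthogonal) change of basis the coefficient matrix of $x_1$ may be taken diagonal, which gives the displayed form. $f_{x_i}$ is obtained from $f$ by setting all variables except $x_i$ to zero. *)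

(* Defs.v *)
From mathcomp Require Export all_boot all_order all_algebra reals complex mpoly.
Export GRing.Theory.
Export Num.Theory.
Set Implicit Arguments.
Unset Strict Implicit.
Unset Printing Implicit Defensive.
Local Open Scope ring_scope.
Local Open Scope complex_scope.
Local Open Scope sesquilinear_scope.

(* det (I + x_1 A_1 + ... + x_n A_n), as a polynomial in x_1, ..., x_n *)
Definition det_pencil (K : comNzRingType) (n d : nat) (A : 'I_n -> 'M[K]_d) :
    {mpoly K[n]} :=
  \det (1%:M + \sum_(i < n) 'X_i *: map_mx (@mpolyC n K) (A i)).

(* f(0, ..., 0, x_i, 0, ..., 0) *)
Definition restrict_var (K : comNzRingType) (n : nat) (f : {mpoly K[n]})
    (i : 'I_n) : {poly K} :=
  mmap polyC (fun j => if j == i then 'X else 0) f.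

(* The variables are indexed from 0, so ord0 is the index of x_1, whose
   coefficient matrix is diagonal.  V ord0 is unused. *)
Definition orthogonal_coeffs (R : realType) (n d : nat)
    (D : 'I_n.+1 -> 'rV[R]_d) (V A : 'I_n.+1 -> 'M[R]_d) : Prop :=
  A ord0 = diag_mx (D ord0) /\
  forall i, i != ord0 ->
    V i *m (V i)^T = 1%:M /\ A i = V i *m diag_mx (D i) *m (V i)^T.

Definition unitary_coeffs (R : realType) (n d : nat)
    (D : 'I_n.+1 -> 'rV[R]_d) (V A : 'I_n.+1 -> 'M[R[i]]_d) : Prop :=
  let Dc i := diag_mx (map_mx (real_complex R) (D i)) in
  A ord0 = Dc ord0 /\
  forall i, i != ord0 ->
    V i \is unitarymx /\ A i = V i *m Dc i *m (V i)^t*.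

(* The nonzero eigenvalues of A are exactly the numbers - 1 / r for r a root
   of p, and the multiplicities agree.  As 0^-1 = 0 in MathComp, the first
   clause also says that 0 is not a root of p. *)
Definition nonzero_eigenvalues_neg_recip_roots (F : fieldType) (d : nat)
    (A : 'M[F]_d) (p : {poly F}) : Prop :=
  (forall z : F, (z != 0 /\ eigenvalue A z) <->
     exists2 r : F, root p r & z = - r^-1) /\
  (forall z : F, z != 0 -> mup z (char_poly A) = mup (- z^-1) p).

(* Main.v *)
Require Import Defs.
Set Implicit Arguments.
Unset Strict Implicit.
Unset Printing Implicit Defensive.
Local Open Scope ring_scope.
Local Open Scope complex_scope.

(** All variables but [x_i] set to zero, the pencil becomes [I + x_i A_i],
    whatever the other coefficient matrices are.  The matrix [A_i] is
    conjugate to a diagonal matrix with entries [a_1, ..., a_d], and a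
    conjugation [V _ V^-1] of [A_i] is also one of [t I - A_i] and of
    [I + t A_i], hence
      [det (t I - A_i) = (t - a_1) ... (t - a_d)] and
      [det (I + t A_i) = (1 + a_1 t) ... (1 + a_d t)].
    For [z <> 0] the factor [t - a] vanishes at [z] exactly when the factor
    [1 + a t] vanishes at [- 1 / z], and then both zeros are simple; comparing
    the two products factor by factor ([mup_char_poly_reciprocal]) gives the
    equality of multiplicities.  Roots being the points of positive
    multiplicity, the description of the set of nonzero eigenvalues follows,
    once it is observed that [det (I + t A_i)] is [1] at [t = 0]. *)

Section Multiplicity.
Variable F : fieldType.

Lemma mup_prod (I : Type) (r : seq I) (p : I -> {poly F}) (x : F) :
  (forall i, p i != 0) ->
  mup x (\prod_(i <- r) p i) = (\sum_(i <- r) mup x (p i))%N.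
Proof.
move=> p_neq0; elim: r => [|i r IHr].
  by rewrite !big_nil mupNroot // rootE hornerC oner_eq0.
rewrite !big_cons mupM ?IHr //.
apply: (big_ind (fun q : {poly F} => q != 0)) => //; first exact: oner_neq0.
exact: mulf_neq0.
Qed.

Lemma root_mup_gt0 (p : {poly F}) (x : F) :
  p != 0 -> root p x = (0 < mup x p)%N.
Proof. by move=> p_neq0; rewrite -XsubC_dvd ?dvdp_XsubCl. Qed.

Lemma mup_XsubC (x a : F) : mup x ('X - a%:P) = (a == x).
Proof. by rewrite -['X - _]expr1 mup_XsubCX; case: eqP. Qed.

Lemma one_addcX_neq0 (a : F) : 1 + a *: 'X != 0 :> {poly F}.
Proof.
apply/negP => /eqP/(congr1 (horner^~ 0))/eqP.
by rewrite !hornerE oner_eq0.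
Qed.

(** The hypothesis on [z] also covers [a = 0]: the factor is then the constant
    [1], with no root, while [a] differs from [z]. *)
Lemma mup_one_addcX (z a : F) :
  z != 0 -> mup (- z^-1) (1 + a *: 'X) = (a == z).
Proof.
move=> z_neq0; have [->|a_neq_z] := eqVneq a z.
  have -> : 1 + z *: 'X = z%:P * ('X - (- z^-1)%:P).
    by rewrite polyCN opprK mulrDr -polyCM divff // mul_polyC addrC.
  by rewrite mupMr ?mup_XsubC ?eqxx // rootE hornerC.
apply: mupNroot; rewrite rootE !hornerE mulrN subr_eq0 eq_sym.
by apply: contra a_neq_z => /eqP az1; rewrite -[a](divfK z_neq0) az1 mul1r.
Qed.

End Multiplicity.

Section Diagonalizable.
Variables (F : fieldType) (d : nat) (a : 'rV[F]_d) (V W A : 'M[F]_d).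
Hypotheses (VW1 : V *m W = 1%:M) (A_def : A = V *m diag_mx a *m W).

Let polyV := map_mx polyC V.
Let polyW := map_mx polyC W.

Let polyVW1 : polyV *m polyW = 1%:M.
Proof. by rewrite -map_mxM VW1 map_mx1. Qed.

Let det_conj (B : 'M[{poly F}]_d) : \det (polyV *m B *m polyW) = \det B.
Proof.
by rewrite !det_mulmx mulrC mulrA -det_mulmx (mulmx1C polyVW1) det1 mul1r.
Qed.

Let polyA : map_mx polyC A = polyV *m diag_mx (map_mx polyC a) *m polyW.
Proof. by rewrite A_def !map_mxM map_diag_mx. Qed.

Lemma char_poly_diagonalizable :
  char_poly A = \prod_j ('X - (a 0 j)%:P).
Proof.
rewrite /char_poly /char_poly_mx polyA.
have -> : 'X%:M - polyV *m diag_mx (map_mx polyC a) *m polyW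
        = polyV *m diag_mx (\row_j ('X - (a 0 j)%:P)) *m polyW.
  have -> : diag_mx (\row_j ('X - (a 0 j)%:P))
          = 'X%:M - diag_mx (map_mx polyC a).
    by apply/matrixP => j k; rewrite !mxE -mulrnBl; congr (_ *+ _).
  by rewrite mulmxBr mulmxBl mul_mx_scalar -scalemxAl polyVW1 scalemx1.
by rewrite det_conj det_diag; apply: eq_bigr => j _; rewrite mxE.
Qed.

Lemma det_one_addX_diagonalizable :
  \det (1%:M + 'X *: map_mx polyC A) = \prod_j (1 + a 0 j *: 'X).
Proof.
rewrite polyA.
have -> : 1%:M + 'X *: (polyV *m diag_mx (map_mx polyC a) *m polyW)
        = polyV *m diag_mx (\row_j (1 + a 0 j *: 'X)) *m polyW.
  have -> : diag_mx (\row_j (1 + a 0 j *: 'X))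
          = 1%:M + 'X *: diag_mx (map_mx polyC a).
    apply/matrixP => j k; rewrite !mxE -mul_polyC mulrC.
    by case: eqP; rewrite ?mulr0n ?mulr0 ?addr0 ?mulr1n.
  by rewrite mulmxDr mulmxDl mulmx1 polyVW1 -scalemxAr -scalemxAl.
by rewrite det_conj det_diag; apply: eq_bigr => j _; rewrite mxE.
Qed.

(** For [z <> 0] both sides count the indices [j] with [a 0 j = z]. *)
Lemma mup_char_poly_reciprocal (z : F) : z != 0 ->
  mup z (char_poly A) = mup (- z^-1) (\det (1%:M + 'X *: map_mx polyC A)).
Proof.
move=> z_neq0; rewrite char_poly_diagonalizable det_one_addX_diagonalizable.
rewrite !mup_prod => [|j|j]; [|exact: one_addcX_neq0|by rewrite polyXsubC_eq0].
by apply: eq_bigr => j _; rewrite mup_XsubC mup_one_addcX.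
Qed.

Lemma eigenvalues_det_one_addX :
  nonzero_eigenvalues_neg_recip_roots A (\det (1%:M + 'X *: map_mx polyC A)).
Proof.
set p := \det _.
have p0_neq0 : ~~ root p 0.
  rewrite /p det_one_addX_diagonalizable rootE horner_prod big1 ?oner_eq0 //.
  by move=> j _; rewrite !hornerE.
have p_neq0 : p != 0 by apply: contraNneq p0_neq0 => ->; rewrite root0.
have eigenvalue_root z : z != 0 -> eigenvalue A z = root p (- z^-1).
  move=> z_neq0; rewrite eigenvalue_root_char !root_mup_gt0 //.
    by rewrite mup_char_poly_reciprocal.
  exact/monic_neq0/char_poly_monic.
split=> [z|]; last exact: mup_char_poly_reciprocal.
split=> [[z_neq0 Az]|[r pr ->]].
  by exists (- z^-1); rewrite -?eigenvalue_root // invrN invrK opprK.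
have r_neq0 : r != 0 by apply: contraNneq p0_neq0 => <-.
have nr_neq0 : - r^-1 != 0 by rewrite oppr_eq0 invr_eq0.
by split; rewrite // eigenvalue_root // invrN invrK opprK.
Qed.

End Diagonalizable.

Section Restriction.
Variables (K : comNzRingType) (n d : nat).

Lemma restrict_det_pencil (A : 'I_n -> 'M[K]_d) (i : 'I_n) :
  restrict_var (det_pencil A) i = \det (1%:M + 'X *: map_mx polyC (A i)).
Proof.
rewrite /restrict_var /det_pencil -det_map_mx; congr (\det _).
apply/matrixP => j k; rewrite !mxE rmorphD rmorph_nat; congr (_ + _).
rewrite summxE rmorph_sum (bigD1 i) //= big1 => [|l /negPf l_neq_i].
  by rewrite !mxE rmorphM /= mmapX mmap1U eqxx mmapC addr0.
by rewrite !mxE rmorphM /= mmapX mmap1U l_neq_i mul0r.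
Qed.

(** A real [f] may have a complex pencil, so the restriction has to be moved
    past the extension of scalars before the pencil can be substituted. *)
Lemma map_restrict_var (L : comNzRingType) (g : {rmorphism K -> L})
    (f : {mpoly K[n]}) (i : 'I_n) :
  map_poly g (restrict_var f i) = restrict_var (map_mpoly g f) i.
Proof.
rewrite /restrict_var (map_mpolyE _ (leqnn (msize f))).
rewrite (mmapE _ (leqnn (msize f))).
rewrite !rmorph_sum /=; apply: eq_bigr => m _.
rewrite mmapZ mmapX rmorphM /= map_polyC; congr (_ * _).
rewrite /mmap1 rmorph_prod; apply: eq_bigr => j _.
by rewrite rmorphXn /=; case: ifP => _; rewrite ?map_polyX ?rmorph0.
Qed.

Lemma map_det_pencil (L : comNzRingType) (g : {rmorphism K -> L})
    (A : 'I_n -> 'M[K]_d) :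
  map_mpoly g (det_pencil A) = det_pencil (fun i => map_mx g (A i)).
Proof.
rewrite /det_pencil -det_map_mx; congr (\det _).
apply/matrixP => j k; rewrite !mxE rmorphD rmorph_nat; congr (_ + _).
rewrite !summxE rmorph_sum; apply: eq_bigr => l _.
by rewrite !mxE rmorphM /= map_mpolyC /map_mpoly mmapX mmap1U.
Qed.

End Restriction.

Theorem lemma3p3 (R : realType) (n d : nat) (f : {mpoly R[n.+1]})
    (hdeg : msize f = d.+1) :
  (forall (D : 'I_n.+1 -> 'rV[R]_d) (V A : 'I_n.+1 -> 'M[R]_d),
     orthogonal_coeffs D V A ->
     f = det_pencil A ->
     forall i : 'I_n.+1,
       nonzero_eigenvalues_neg_recip_roots
         (map_mx (real_complex R) (A i))
         (map_poly (real_complex R) (restrict_var f i))) /\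
  (forall (D : 'I_n.+1 -> 'rV[R]_d) (V A : 'I_n.+1 -> 'M[R[i]]_d),
     unitary_coeffs D V A ->
     map_mpoly (real_complex R) f = det_pencil A ->
     forall i : 'I_n.+1,
       nonzero_eigenvalues_neg_recip_roots
         (A i)
         (map_poly (real_complex R) (restrict_var f i))).
Proof.
split=> D V A [A0 Ai] f_def i; rewrite map_restrict_var.
  rewrite f_def map_det_pencil restrict_det_pencil.
  have [->|/Ai [VVT1 ->]] := eqVneq i ord0.
    apply: (@eigenvalues_det_one_addX _ _ (map_mx (real_complex R) (D ord0))
              1%:M 1%:M); first by rewrite mulmx1.
    by rewrite A0 map_diag_mx mulmx1 mul1mx.
  apply: (@eigenvalues_det_one_addX _ _ (map_mx (real_complex R) (D i))
            (map_mx (real_complex R) (V i)) (map_mx (real_complex R) (V i)^T)).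
    by rewrite -map_mxM VVT1 map_mx1.
  by rewrite !map_mxM map_diag_mx.
rewrite f_def restrict_det_pencil.
have [->|/Ai [/unitarymxP VVt1 ->]] := eqVneq i ord0.
  rewrite A0.
  apply: (@eigenvalues_det_one_addX _ _ _ 1%:M 1%:M); first by rewrite mulmx1.
  by rewrite mulmx1 mul1mx.
exact: (eigenvalues_det_one_addX VVt1 (erefl _)).
Qed.
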